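(* Let $\Gamma=\langle S_\Gamma\rangle$ and $\Lambda=\langle S_\Lambda\rangle$ be two finitely generated groups with fixed finite generating systems, such that the Cayley graphs $(\Gamma,S_\Gamma)$ and $(\Lambda,S_\Lambda)$ are isometric. Let $m_\Lambda$ be the Haar probability measure on $\mathrm{Iso}(\Gamma,\Lambda)/\Lambda$ and $m_\Gamma$ the Haar probability measure on $\mathrm{Iso}(\Lambda,\Gamma)/\Gamma$. Then the p.m.p. actions $\Gamma\curvearrowright(\mathrm{Iso}(\Gamma,\Lambda)/\Lambda,m_\Lambda)$ and $\Lambda\curvearrowright(\mathrm{Iso}(\Lambda,\Gamma)/\Gamma,m_\Gamma)$ are isometric orbit equivalent (with respect to $S_\Gamma$ and $S_\Lambda$).
   Context: A finite generating system is a finite symmetric generating set not containing the identity. The Cayley graph $(\Gamma,S_\Gamma)$ has vertex set $\Gamma$ and edges $\{\gamma,\gamma s\}$, $s\in S_\Gamma$, with the graph distance. $\mathrm{Iso}(\Gamma,\Lambda)$ is the space of bijective isometries from $(\Gamma,S_\Gamma)$ to $(\Lambda,S_\Lambda)$, with the topology of pointwise convergence; the Cayley graphs are isometric if it is nonempty. $\mathrm{Iso}(\Gamma)=\mathrm{Iso}(\Gamma,\Gamma)$ is a group containing $\Gamma$ as left translations. $\mathrm{Iso}(\Gamma)$ acts simply transitively on $\mathrm{Iso}(\Gamma,\Lambda)$ by precomposition by the inverse, and $\mathrm{Iso}(\Lambda)$ acts simply transitively on it by postcomposition; the Haar measure on $\mathrm{Iso}(\Gamma,\Lambda)$ is the unique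 (up to scaling) nonzero Radon measure invariant under both actions. $\mathrm{Iso}(\Gamma,\Lambda)/\Lambda$ is the quotient by the action of $\Lambda$ by postcomposition, $\lambda\cdot f:\gamma\mapsto\lambda f(\gamma)$, and $\Gamma$ acts on it by $\gamma[f]=[\delta\mapsto f(\gamma^{-1}\delta)]$. The Haar probability measure on $\mathrm{Iso}(\Gamma,\Lambda)/\Lambda$ is the image of the Haar measure restricted to the compact open fundamental domain $\{f\in\mathrm{Iso}(\Gamma,\Lambda): f(1_\Gamma)=1_\Lambda\}$ and normalized to have mass $1$. The space $\mathrm{Iso}(\Lambda,\Gamma)/\Gamma$, its $\Lambda$-action and its Haar probability measure are defined by exchanging the roles of $\Gamma$ and $\Lambda$. Isometric orbit equivalence: for a p.m.p. action $\alpha$ of $\Gamma$ on $(X,\mu)$ (an action by measure-preserving bimeasurable bijections of a standard probability space), let $d_{\alpha(S_\Gamma)}(x,x')\in\mathbb{N}\cup\{+\infty\}$ be the graph distance on the graph with vertex set $X$ and edge set $\{(x,x') : \exists s\in S_\Gamma,\ \alpha(s)x=x'\}$. Two p.m.p. actions $\Gamma\curvearrowright^\alpha(X,\mu)$ and $\Lambda\curvearrowright^\beta(Y,\nu)$ are isometric orbit equivalent if there exist a bimeasurable bijection $\Phi:X\to Y$ with $\Phi_*\mu=\nu$ and a $\Gamma$-invariant measurable set $X_0\subseteq X$ with $\mu(X_0)=1$ such that $\Phi(X_0)$ is $\Lambda$-invariant and $d_{\beta(S_\Lambda)}(\Phi(x),\Phi(x'))=d_{\alpha(S_\Gamma)}(x,x')$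 for all $x,x'\in X_0$. *)

(* Defs.v *)
From HB Require Import structures.
From mathcomp Require Import all_boot all_order all_algebra generic_quotient.
From mathcomp Require Import all_classical all_reals all_analysis.

Set Implicit Arguments.
Unset Strict Implicit.
Unset Printing Implicit Defensive.

Local Open Scope classical_set_scope.

Section GraphDistance.
Variables (V : Type) (edge : V -> V -> Prop).

Fixpoint walk (n : nat) (x y : V) : Prop :=
  if n is m.+1 then exists2 z, edge x z & walk m z y else x = y.

(* [None] stands for +oo. *)
Definition graph_dist (x y : V) : option nat :=
  match pselect (exists n, `[< walk n x y >]) with
  | left h => Some (ex_minn h)
  | right _ => None
  end.

End GraphDistance.

Lemma eq_graph_dist (V W : Type) (e : V -> V -> Prop) (e' : W -> W -> Prop)
    x y x' y' : (forall n, walk e n x y <-> walk e' n x' y') ->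
  graph_dist e x y = graph_dist e' x' y'.
Proof.
move=> E; rewrite /graph_dist.
case: pselect => [h|h]; case: pselect => [h'|h'] //.
- congr Some; case: ex_minnP => m /asboolP wm minm.
  case: ex_minnP => n /asboolP wn minn; apply/eqP; rewrite eqn_leq.
  by apply/andP; split; [apply: minm | apply: minn]; apply/asboolP/E.
- by case: h'; case: h => n /asboolP/E w; exists n; apply/asboolP.
- by case: h; case: h' => n /asboolP/E w; exists n; apply/asboolP.
Qed.

Section Cayley.
Variable G : groupType.

Definition is_subgroup (H : set G) : Prop :=
  [/\ H 1%g, forall x y, H x -> H y -> H (x * y)%g & forall x, H x -> H x^-1%g].

Record finite_generating_system (S : set G) : Prop := {
  fgs_finite : finite_set S;
  fgs_symmetric : forall s, S s -> S s^-1%g;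
  fgs_not1 : ~ S 1%g;
  fgs_generates : forall H : set G, is_subgroup H -> S `<=` H -> H = setT }.

Definition cayley_edge (S : set G) (x y : G) : Prop :=
  exists2 s, S s & y = (x * s)%g.

Definition cayley_dist (S : set G) : G -> G -> option nat :=
  graph_dist (cayley_edge S).

End Cayley.

Definition iso_set (G L : groupType) (SG : set G) (SL : set L) :
    set {ptws G -> discrete_topology L} :=
  [set f | bijective f /\
           forall x y, cayley_dist SL (f x) (f y) = cayley_dist SG x y].

(* [set_type] carries the subspace topology, here that of pointwise convergence
   for the discrete topology on [L]. *)
Definition iso (G L : groupType) (SG : set G) (SL : set L) : Type :=
  set_type (iso_set SG SL).

Definition cayley_isometric (G L : groupType) (SG : set G) (SL : set L) : Prop :=
  iso_set SG SL !=set0.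

Definition iso_fun (G L : groupType) (SG : set G) (SL : set L)
  (f : iso SG SL) : G -> L := set_val f.
Coercion iso_fun : iso >-> Funclass.

Section IsoBasics.
Variables (G L : groupType) (SG : set G) (SL : set L).

Lemma isoP (f : iso SG SL) : iso_set SG SL (iso_fun f).
Proof. exact: set_mem (valP f). Qed.

Lemma iso_ext (f g : iso SG SL) : (forall x, f x = g x) -> f = g.
Proof. by move=> fg; apply: val_inj; apply/funext. Qed.

Definition iso_mk (f : G -> L) (hf : iso_set SG SL f) : iso SG SL :=
  exist _ (f : {ptws G -> discrete_topology L}) (mem_set hf).

End IsoBasics.

Section IsoConstructions.
Variables (G L P : groupType) (SG : set G) (SL : set L) (SP : set P).

Lemma iso_comp_subproof (g : iso SL SP) (f : iso SG SL) :
  iso_set SG SP (g \o f).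
Proof.
have [bf df] := isoP f; have [bg dg] := isoP g; split; first exact: bij_comp.
by move=> x y /=; rewrite dg df.
Qed.

Definition iso_comp (g : iso SL SP) (f : iso SG SL) : iso SG SP :=
  iso_mk (iso_comp_subproof g f).

End IsoConstructions.

Section IsoInverse.
Variables (G L : groupType) (SG : set G) (SL : set L).

Lemma iso_inv_subproof (f : iso SG SL) :
  {g : L -> G | [/\ cancel f g, cancel g f & iso_set SL SG g]}.
Proof.
apply: cid; have [[g fK gK] df] := isoP f; exists g; split=> //.
split; first by exists f.
by move=> x y; rewrite -df !gK.
Qed.

Definition iso_inv (f : iso SG SL) : iso SL SG :=
  let: exist _ h := iso_inv_subproof f in iso_mk (let: And3 _ _ h3 := h in h3).

Lemma iso_invK (f : iso SG SL) : cancel f (iso_inv f).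
Proof. by rewrite /iso_inv; case: iso_inv_subproof => g []. Qed.

Lemma iso_invVK (f : iso SG SL) : cancel (iso_inv f) f.
Proof. by rewrite /iso_inv; case: iso_inv_subproof => g []. Qed.

Lemma cayley_isometric_sym :
  cayley_isometric SG SL -> cayley_isometric SL SG.
Proof. by case=> f hf; exists (iso_inv (iso_mk hf)); exact: isoP. Qed.

End IsoInverse.

Section LeftTranslation.
Variables (G : groupType) (S : set G).

Lemma walk_ltrans (g : G) n x y :
  walk (cayley_edge S) n (g * x)%g (g * y)%g <-> walk (cayley_edge S) n x y.
Proof.
elim: n x y => [|n IH] x y /=; first by split=> [/mulgI|->].
split=> -[z [s Ss ->] w].
  by exists (x * s)%g; [exists s | apply/IH; rewrite mulgA].
by exists (g * (x * s))%g; [exists s; rewrite ?mulgA | apply/IH].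
Qed.

Lemma ltrans_subproof (g : G) : iso_set S S (fun x => g * x)%g.
Proof.
split; first by exists (fun x => g^-1 * x)%g => x; rewrite ?mulKg ?mulVKg.
by move=> x y; apply: eq_graph_dist => n; exact: walk_ltrans.
Qed.

Definition ltrans (g : G) : iso S S := iso_mk (ltrans_subproof g).

End LeftTranslation.

(* A measurable type of the library has to be pointed, hence the proof [h] of
   nonemptiness as a parameter; the point plays no other role. *)
Section IsoSpace.
Variables (G L : groupType) (SG : set G) (SL : set L).

Definition iso_space (h : cayley_isometric SG SL) : Type := iso SG SL.

Variable h : cayley_isometric SG SL.

HB.instance Definition _ := Topological.on (iso_space h).
HB.instance Definition _ :=
  isPointed.Build (iso_space h) (iso_mk (projT2 (cid h))).

Definition iso_borel := g_sigma_algebraType (@open (iso_space h)).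

Definition postcomp_equiv (f g : iso_space h) : bool :=
  `[< exists l : L, g = iso_comp (ltrans SL l) f >].

Lemma postcomp_equiv_refl : reflexive postcomp_equiv.
Proof.
by move=> f; apply/asboolP; exists 1%g; apply: iso_ext => x; rewrite -[LHS]mul1g.
Qed.

Lemma postcomp_equiv_sym : symmetric postcomp_equiv.
Proof.
move=> f g; apply/asbool_equiv_eq; split=> -[l ->]; exists l^-1%g;
  by apply: iso_ext => x; rewrite -[LHS](mulKg l).
Qed.

Lemma postcomp_equiv_trans : transitive postcomp_equiv.
Proof.
move=> f g k /asboolP[l ->] /asboolP[m ->]; apply/asboolP; exists (m * l)%g.
by apply: iso_ext => x; rewrite -[RHS]mulgA.
Qed.

Canonical postcomp_equiv_rel :=
  EquivRel postcomp_equiv postcomp_equiv_refl postcomp_equiv_sym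
    postcomp_equiv_trans.

Definition iso_quot := quotient_topology {eq_quot postcomp_equiv_rel}%qT.

Definition iso_quot_borel := g_sigma_algebraType (@open iso_quot).

Definition class_of (f : iso_space h) : iso_quot := (\pi_iso_quot f)%qT.

Definition quot_act (g : G) (q : iso_quot_borel) : iso_quot_borel :=
  class_of (iso_comp (repr (q : iso_quot)) (ltrans SG g^-1%g)).

Lemma quot_act_class (g : G) (f : iso_space h) :
  quot_act g (class_of f) = class_of (iso_comp f (ltrans SG g^-1%g)).
Proof.
rewrite /quot_act; apply/eqmodP => /=.
have /eqmodP/asboolP[l fE] : class_of f = class_of (repr (class_of f)).
  by rewrite /class_of reprK.
rewrite /= postcomp_equiv_sym; apply/asboolP; exists l.
by apply: iso_ext => x; rewrite fE.
Qed.

End IsoSpace.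

Arguments class_of {G L SG SL} h f.
Arguments quot_act {G L SG SL} h g q.

Section Measures.
Context {R : realType}.
Local Open Scope ring_scope.
Local Open Scope ereal_scope.

(* Only applied to Hausdorff [T], where compact sets are Borel. *)
Record radon (T : ptopologicalType)
    (mu : {measure set (g_sigma_algebraType (@open T)) -> \bar R}) : Prop := {
  radon_compact : forall K : set T, compact K -> mu K < +oo;
  radon_outer : forall A : set T, <<s @open T >> A ->
    mu A = ereal_inf [set mu U | U in [set U : set T | open U /\ A `<=` U]];
  radon_inner : forall U : set T, open U ->
    mu U = ereal_sup [set mu K | K in [set K : set T | compact K /\ K `<=` U]] }.

Section Haar.
Variables (G L : groupType) (SG : set G) (SL : set L).
Variable h : cayley_isometric SG SL.

Record is_haar (mu : {measure set (iso_borel h) -> \bar R}) : Prop := {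
  haar_radon : radon mu;
  haar_neq0 : mu setT != 0;
  haar_pre : forall (phi : iso SG SG) (A : set (iso_borel h)), measurable A ->
    mu ((fun f : iso_space h => iso_comp f (iso_inv phi)) @^-1` A) = mu A;
  haar_post : forall (psi : iso SL SL) (A : set (iso_borel h)), measurable A ->
    mu ((fun f : iso_space h => iso_comp psi f) @^-1` A) = mu A }.

Definition fund_dom : set (iso_space h) := [set f | iso_fun f 1%g = 1%g].

(* [c] is the normalizing constant: [m] has mass 1 as a [probability]. *)
Definition is_haar_probability (m : probability (iso_quot_borel h) R) : Prop :=
  exists (mu : {measure set (iso_borel h) -> \bar R}) (c : R), is_haar mu /\
    forall A : set (iso_quot_borel h), measurable A ->
      m A = c%:E * mu (fund_dom `&` class_of h @^-1` A).

End Haar.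

(* A complete pseudometric space that is Hausdorff is a complete metric space,
   so [M] ranges over the Polish spaces. *)
Definition standard_borel d (X : measurableType d) : Prop :=
  exists (M : completePseudoMetricType R) (b : X -> M),
    [/\ hausdorff_space M, exists2 D : set M, countable D & dense D,
        bijective b &
        forall A : set X, measurable A <-> <<s @open M >> (b @` A)].

(* The maps [a g] are bijective with measurable inverse [a g^-1]. *)
Record pmp_action (G : groupType) d (X : measurableType d)
    (mu : probability X R) (a : G -> X -> X) : Prop := {
  pmp_standard : standard_borel X;
  pmp_act1 : forall x, a 1%g x = x;
  pmp_actM : forall g g' x, a (g * g')%g x = a g (a g' x);
  pmp_measurable : forall g, measurable_fun setT (a g);
  pmp_preserve : forall g (A : set X), measurable A ->
    mu (a g @^-1` A) = mu A }.

Definition action_edge (G : groupType) (S : set G) (X : Type) (a : G -> X -> X)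
  (x x' : X) : Prop := exists2 s, S s & a s x = x'.

Definition action_dist (G : groupType) (S : set G) (X : Type)
  (a : G -> X -> X) : X -> X -> option nat := graph_dist (action_edge S a).

Definition invariant_set (G : groupType) (X : Type) (a : G -> X -> X)
  (A : set X) : Prop := forall g, a g @` A = A.

Definition isometric_orbit_equivalent (G L : groupType) (SG : set G)
    (SL : set L) dX (X : measurableType dX) dY (Y : measurableType dY)
    (mu : probability X R) (nu : probability Y R)
    (a : G -> X -> X) (b : L -> Y -> Y) : Prop :=
  exists (Phi : X -> Y) (Psi : Y -> X) (X0 : set X),
    [/\ cancel Phi Psi /\ cancel Psi Phi,
        measurable_fun setT Phi /\ measurable_fun setT Psi,
        forall A : set Y, measurable A -> mu (Phi @^-1` A) = nu A,
        [/\ measurable X0, mu X0 = 1, invariant_set a X0 &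
            invariant_set b (Phi @` X0)] &
        forall x x', X0 x -> X0 x' ->
          action_dist SL b (Phi x) (Phi x') = action_dist SG a x x'].

End Measures.

(* Main.v *)
Require Import Defs.
From HB Require Import structures.
From mathcomp Require Import all_boot all_order all_algebra.
From mathcomp Require Import all_classical all_reals all_analysis.

(** Every class of Iso(G, L) / L contains exactly one isometry f with
    f(1) = 1; call it the normal form of the class.  Hence inversion of normal
    forms, [f] |-> [f^-1], is a bijection Phi from Iso(G, L) / L onto
    Iso(L, G) / G, and Phi is the orbit equivalence.

    Phi preserves distances.  The normal form of s[f] is
    x |-> f(s^-1)^-1 f(s^-1 x), and inverting it shows that
    Phi(s[f]) = f(s^-1)^-1 Phi([f]).  As f is an isometry fixing 1, it maps the
    generator s^-1 to a generator, so Phi maps edges to edges; so does its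
    inverse, which is defined in the same way ([quot_inv_edge],
    [quot_inv_dist]).

    Phi preserves the measures.  Both quotients are torsors under compact
    groups: on Iso(G, L) / L the stabilizer K of 1 in Iso(L) acts by
    postcomposition of normal forms, and Phi turns this action into
    precomposition on Iso(L, G) / G.  Bi-invariance of the Haar measures makes
    m_L, and the transport of m_G along Phi^-1, both K-invariant.  A K-invariant
    probability measure is unique ([stab_invariant_unique]): prescribing the
    values of the normal form on a fixed finite list of elements of G cuts the
    quotient into countably many cylinders, K permutes the nonempty ones
    transitively, so they have equal masses with total 1, and the cylinders form
    a pi-system generating the Borel sets.

    G preserves m_L.  Moving g across the quotient map replaces the fundamental
    domain {f(1) = 1} for L by {f(g) = 1}.  Any two fundamental domains of a
    countable group of measure-preserving maps cut out the same mass
    from an invariant set ([haar_change_fund_dom]).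

    The quotient is a standard Borel space because the metric comparing normal
    forms and their inverses along enumerations of G and L is complete, exactly
    as for the group of permutations of a countable set. *)

Set Implicit Arguments.
Unset Strict Implicit.
Unset Printing Implicit Defensive.
Import Order.TTheory GRing.Theory Num.Theory.

Local Open Scope classical_set_scope.

(** * The topology of pointwise convergence *)

Section Topology.
Variables (G L : groupType) (SG : set G) (SL : set L).

Definition agree_on (f : G -> L) (s : seq G) : set (G -> L) :=
  [set g | {in s, forall x, g x = f x}].

(** Since the target is discrete, the sets of functions agreeing with [f] on
    finite lists are a filter base at [f]; this filter converges to [f] because
    it does so at each point. *)
Lemma nbhs_ptws_agree (f : {ptws G -> discrete_topology L})
    (U : set {ptws G -> discrete_topology L}) :
  nbhs f U <-> exists s : seq G, agree_on f s `<=` U.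
Proof.
split=> [|[s sU]].
  pose F := filter_from [set: seq G] (agree_on f).
  have FF : Filter F.
    apply: filter_from_filter; first by exists [::].
    move=> s t _ _; exists (s ++ t) => // g gst.
    by split=> x xs; apply: gst; rewrite mem_cat xs ?orbT.
  suff Ff : F --> f by move=> /Ff[s _ sU]; exists s.
  apply/cvg_sup => x; apply/cvg_image; first by apply/seteqP; split=> // l _;
    by exists (fun=> l).
  move=> A /principal_filterP Afx.
  exists [set g : G -> L | A (g x)].
    by exists [:: x] => // g /(_ x); rewrite inE => /(_ (eqxx x)) /= ->.
  by apply/seteqP; split=> [_ [g Ag <-]//|l Al]; exists (fun=> l).
have Ff : Filter (nbhs f) by exact: nbhs_filter.
suff: nbhs f (agree_on f s) by exact: (@filterS _ (nbhs f) _ _ _ sU).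
move=> {sU}.
elim: s => [|x s IH]; first exact: (@filterE _ (nbhs f)).
have /= fx : nbhs f (proj x @^-1` [set f x]).
  by apply: proj_continuous; apply/principal_filterP.
apply: (@filterS _ (nbhs f) _ _ _ _ (filterI fx IH)) => g [gx gs] y.
rewrite inE => /predU1P[->//|].
exact: gs.
Qed.

Lemma nbhs_iso_agree (f : iso SG SL) (U : set (iso SG SL)) :
  nbhs f U <->
  exists s : seq G, forall g : iso SG SL, {in s, forall x, g x = f x} -> U g.
Proof.
split=> [[_ [[B oB <-] Bf] BU]|[s sU]].
  have /nbhs_ptws_agree[s sB] : nbhs (set_val f) B by apply: open_nbhs_nbhs.
  by exists s => g gs; apply: BU; apply: sB.
have fs : nbhs (set_val f) (agree_on f s) by apply/nbhs_ptws_agree; exists s.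
have Ff : Filter (nbhs f) by exact: nbhs_filter.
apply: (@filterS _ (nbhs f) _ _ _ _ (@initial_continuous _ _ set_val f _ fs)) => g gs.
exact: sU.
Qed.

Lemma open_iso_agree (U : set (iso SG SL)) :
  open U <-> forall f, U f ->
  exists s : seq G, forall g : iso SG SL, {in s, forall x, g x = f x} -> U g.
Proof.
rewrite openE; split=> oU f Uf; first by apply/nbhs_iso_agree/oU.
by rewrite /interior; apply/nbhs_iso_agree/oU.
Qed.

End Topology.

(** * Countability of finitely generated groups *)

Section Countability.

Lemma countable_seq (T : Type) :
  countable [set: T] -> countable [set: seq T].
Proof.
case/countable_injP => r ri; apply/countable_injP; exists (pickle \o map r).
move=> s t _ _ /= /(pcan_inj pickleK)/inj_map; apply=> x y.
by apply: ri; rewrite inE.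
Qed.

Lemma countable_prod (T U : Type) :
  countable [set: T] -> countable [set: U] -> countable [set: T * U].
Proof. by move=> cT cU; rewrite -setXTT; exact: countableX. Qed.

(** The products of words in the generators form a subgroup, which is
    everything, and there are countably many words. *)
Lemma countable_fgs (G : groupType) (S : set G) :
  finite_generating_system S -> countable [set: G].
Proof.
move=> [fS symS _ genS].
pose W := [set \prod_(x <- w) x | w in [set w : seq G | {in w, forall x, S x}]]%g.
have <- : W = setT.
  apply: genS => [|s Ss]; last first.
    exists [:: s]; last by rewrite big_seq1.
    by move=> x; rewrite inE => /eqP->.
  split.
  - by exists [::]; rewrite // big_nil.
  - move=> _ _ [v Sv <-] [w Sw <-]; exists (v ++ w); last by rewrite big_cat.
    by move=> x; rewrite mem_cat => /orP[/Sv|/Sw].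
  - move=> _ [w Sw <-]; exists (rev [seq x^-1 | x <- w]%g).
      move=> x; rewrite mem_rev => /mapP[y /Sw Sy ->]; exact: symS.
    elim: w {Sw} => [|x w IH]; first by rewrite !big_nil invg1.
    by rewrite big_cons invgM -IH /= rev_cons -cats1 big_cat /= big_seq1.
apply: (@sub_countable _ _ _ [set w : seq G | {in w, forall x, S x}]).
  exact: card_image_le.
have /countable_injP[r ri] : countable S by apply: finite_set_countable.
apply/countable_injP; exists (pickle \o map r) => s t.
rewrite !inE /= => Ss St /(pcan_inj pickleK); elim: s t Ss St => [|x s IH] [|y t] //=.
move=> Ss St [rxy rst].
have -> : x = y by apply: ri rxy; apply/mem_set; [apply: Ss|apply: St]; exact: mem_head.
congr cons; apply: (IH t _ _ rst) => z zs.
  by apply: Ss; rewrite in_cons zs orbT.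
by apply: St; rewrite in_cons zs orbT.
Qed.

Lemma countable_enum (T : choiceType) (x0 : T) :
  countable [set: T] -> exists e : nat -> T, forall x, exists n, e n = x.
Proof.
case/countable_injP => r /in2TT ri; exists (fun n => xget x0 (r @^-1` [set n])).
move=> x; exists (r x); apply: ri.
exact: (xgetI x0 (erefl : (r @^-1` [set r x]) x)).
Qed.

End Countability.

(** * Isometries of Cayley graphs *)

Lemma iso_compA (G1 G2 G3 G4 : groupType) (S1 : set G1) (S2 : set G2)
    (S3 : set G3) (S4 : set G4) (f : iso S3 S4) (g : iso S2 S3) (k : iso S1 S2) :
  iso_comp f (iso_comp g k) = iso_comp (iso_comp f g) k.
Proof. exact: iso_ext. Qed.

Lemma iso_compE (G1 G2 G3 : groupType) (S1 : set G1) (S2 : set G2)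
    (S3 : set G3) (g : iso S2 S3) (f : iso S1 S2) x :
  iso_comp g f x = g (f x).
Proof. by []. Qed.

Lemma ltransE (G1 : groupType) (S1 : set G1) g x : ltrans S1 g x = (g * x)%g.
Proof. by []. Qed.

Lemma iso_inv_inv (G L : groupType) (SG : set G) (SL : set L)
    (f : iso SG SL) :
  iso_inv (iso_inv f) = f.
Proof.
by apply: iso_ext => x; apply: (can_inj (iso_invK (iso_inv f)));
  rewrite iso_invVK iso_invK.
Qed.

Lemma iso_inv_comp (G1 G2 G3 : groupType) (S1 : set G1) (S2 : set G2)
    (S3 : set G3) (g : iso S2 S3) (f : iso S1 S2) :
  iso_inv (iso_comp g f) = iso_comp (iso_inv f) (iso_inv g).
Proof.
apply: iso_ext => x; apply: (can_inj (iso_invK (iso_comp g f))).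
by rewrite iso_invVK !iso_compE !iso_invVK.
Qed.

Lemma iso_inv_ltrans (G : groupType) (S : set G) g :
  iso_inv (ltrans S g) = ltrans S g^-1%g.
Proof.
apply: iso_ext => x; apply: (can_inj (iso_invK (ltrans S g))).
by rewrite iso_invVK !ltransE mulVKg.
Qed.

Lemma iso_inv1 (G L : groupType) (SG : set G) (SL : set L) (f : iso SG SL) :
  f 1%g = 1%g -> iso_inv f 1%g = 1%g.
Proof. by move=> f1; rewrite -{1}f1 iso_invK. Qed.

Lemma graph_dist_eq1 (V : Type) (e : V -> V -> Prop) (x y : V) : x <> y ->
  graph_dist e x y = Some 1%N <-> e x y.
Proof.
move=> xy; rewrite /graph_dist; case: pselect => [ex|nex]; last first.
  split=> // exy; case: nex; exists 1%N; apply/asboolP; exists y => //.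
case: ex_minnP => n /asboolP wn minn; split=> [[n1]|exy].
  by move: wn; rewrite n1 => -[z exz <-].
congr Some; apply/eqP; rewrite eqn_leq minn; last by apply/asboolP; exists y.
by case: n wn {minn} => // /xy.
Qed.

(** Edges of a Cayley graph are the pairs at distance one, because a generator
    is never the identity; so isometries preserve edges. *)
Lemma iso_cayley_edge (G L : groupType) (SG : set G) (SL : set L)
    (f : iso SG SL) x y : finite_generating_system SG ->
  cayley_edge SG x y -> cayley_edge SL (f x) (f y).
Proof.
move=> [_ _ S1 _] exy; have [_ df] := isoP f.
have xy : x <> y.
  case: exy => s Ss -> xs; apply: S1.
  by rewrite -[X in SG X](_ : s = 1%g) //; apply: (@mulgI _ x); rewrite -xs mulg1.
apply/graph_dist_eq1; last by rewrite -/(cayley_dist _ _ _) df; apply/graph_dist_eq1.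
by move=> /(can_inj (iso_invK f)).
Qed.

Lemma walk_homo (V W : Type) (e : V -> V -> Prop) (e' : W -> W -> Prop) (f : V -> W) :
  (forall x y, e x y -> e' (f x) (f y)) ->
  forall n x y, walk e n x y -> walk e' n (f x) (f y).
Proof.
move=> ef; elim=> [|n IH] x y /= => [->//|[z xz zy]].
by exists (f z); [exact: ef | exact: IH].
Qed.

(** * Normal forms of classes and cylinders *)

Section NormalForm.
Variables (G L : groupType) (SG : set G) (SL : set L).

Definition rebase (f : iso SG SL) : iso SG SL :=
  iso_comp (ltrans SL (f 1)^-1)%g f.

Lemma rebaseE f x : rebase f x = ((f 1)^-1 * f x)%g.
Proof. by []. Qed.

Lemma rebase_id (f : iso SG SL) : f 1%g = 1%g -> rebase f = f.
Proof. by move=> f1; apply: iso_ext => x; rewrite rebaseE f1 invg1 mul1g. Qed.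

Variable h : cayley_isometric SG SL.

Lemma class_of_rebase (f : iso SG SL) : class_of h (rebase f) = class_of h f.
Proof.
apply/eqmodP; rewrite /= postcomp_equiv_sym; apply/asboolP.
by exists (f 1)^-1%g.
Qed.

Lemma class_of_postcomp l (f : iso SG SL) :
  class_of h (iso_comp (ltrans SL l) f) = class_of h f.
Proof.
by apply/eqmodP; rewrite /= postcomp_equiv_sym; apply/asboolP; exists l.
Qed.

(** The normal form of a class: its unique element fixing the identity. *)
Definition nrm (q : iso_quot h) : iso SG SL := rebase (repr q).

Lemma class_of_nrm q : class_of h (nrm q) = q.
Proof. by rewrite /nrm class_of_rebase /class_of reprK. Qed.

Lemma nrm1 q : nrm q 1%g = 1%g.
Proof. by rewrite /nrm rebaseE mulVg. Qed.

Lemma nrm_class_of f : nrm (class_of h f) = rebase f.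
Proof.
have /eqmodP/asboolP[l fE] : class_of h f = class_of h (repr (class_of h f)).
  by rewrite /class_of reprK.
apply: iso_ext => x; rewrite /nrm !rebaseE fE.
by rewrite !iso_compE !ltransE invgM -mulgA mulKg.
Qed.

Lemma nrm_inj : injective nrm.
Proof. exact: can_inj class_of_nrm. Qed.

Lemma nrm_quot_act g q x :
  nrm (quot_act h g q) x = ((nrm q g^-1)^-1 * nrm q (g^-1 * x))%g.
Proof.
rewrite -[q in LHS]class_of_nrm quot_act_class nrm_class_of rebaseE.
by rewrite !iso_compE !ltransE mulg1.
Qed.

Lemma quot_act1 q : quot_act h 1%g q = q.
Proof.
apply: nrm_inj; apply: iso_ext => x.
by rewrite nrm_quot_act invg1 mul1g nrm1 invg1 mul1g.
Qed.

Lemma quot_actM g g' q : quot_act h (g * g')%g q = quot_act h g (quot_act h g' q).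
Proof.
rewrite -[q]class_of_nrm !quot_act_class -iso_compA; congr class_of.
by congr iso_comp; apply: iso_ext => x; rewrite !iso_compE !ltransE mulgA invgM.
Qed.

Lemma invariant_setT_quot_act : invariant_set (quot_act h) setT.
Proof.
move=> g; apply/seteqP; split=> // q _; exists (quot_act h g^-1%g q) => //.
by rewrite -quot_actM mulgV quot_act1.
Qed.

(** The normal form of the class of [f] is determined on [s] by the values of
    [f] on [s] and at the identity, so finite lists describe neighborhoods in
    the quotient as they do upstairs. *)
Lemma open_quot_agree (U : set (iso_quot h)) :
  open U <-> forall q, U q -> exists s : seq G,
    forall q', {in s, forall x, nrm q' x = nrm q x} -> U q'.
Proof.
split=> [/open_iso_agree oU q Uq|oU].
  have [|s sU] := oU (nrm q); first by rewrite /preimage/= -/(class_of h _) class_of_nrm.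
  by exists s => q' /sU; rewrite /preimage/= -/(class_of h _) class_of_nrm.
apply/open_iso_agree => f /oU[s sU]; exists (1%g :: s) => g gf.
apply: sU => x xs; rewrite -!/(class_of h _) !nrm_class_of !rebaseE.
by rewrite !gf ?inE ?eqxx ?xs ?orbT.
Qed.

Definition cylinder (w : seq (G * L)) : set (iso_quot h) :=
  [set q | {in w, forall p, nrm q p.1 = p.2}].

Definition cylinders : set (set (iso_quot h)) := range cylinder.

Lemma cylinder_cat v w : cylinder (v ++ w) = cylinder v `&` cylinder w.
Proof.
apply/seteqP; split=> [q qvw|q [qv qw] p]; last first.
  by rewrite mem_cat => /orP[/qv|/qw].
by split=> p pw; apply: qvw; rewrite mem_cat pw ?orbT.
Qed.

Lemma setI_closed_cylinders : setI_closed cylinders.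
Proof. by move=> _ _ [v _ <-] [w _ <-]; exists (v ++ w) => //; exact: cylinder_cat. Qed.

Lemma open_cylinder w : open (cylinder w).
Proof.
apply/open_quot_agree => q qw; exists (map fst w) => q' q'q p pw.
by rewrite q'q ?qw //; exact: map_f.
Qed.

(** An open set is the union of the cylinders it contains, and there are only
    countably many cylinders. *)
Lemma sigma_cylinders : countable [set: G] -> countable [set: L] ->
  <<s @open (iso_quot h) >> = <<s cylinders >>.
Proof.
move=> cG cL; apply/seteqP; split; apply: smallest_sub => //;
  try exact: smallest_sigma_algebra.
  move=> U /open_quot_agree oU.
  rewrite (_ : U = \bigcup_(w in setT)
      (if `[< cylinder w `<=` U >] then cylinder w else set0)).
    apply: (@countable_bigcupT_measurable _ (g_sigma_algebraType cylinders)).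
      exact/countable_seq/countable_prod.
    move=> w; case: asboolP => _; last exact: measurable0.
    by apply: sub_sigma_algebra; exists w.
  apply/seteqP; split=> [q /oU[s sU]|q [w _]]; last by case: asboolP => // wU /wU.
  exists [seq (x, nrm q x) | x <- s] => //; case: asboolP => [_ p /mapP[x xs ->]//|[]].
  by move=> q' q'w; apply: sU => x xs; apply: (q'w (x, nrm q x)); apply: map_f.
move=> _ [w _ <-]; apply: sub_sigma_algebra; exact: open_cylinder.
Qed.

End NormalForm.

(** * Measurability on the space of isometries and its quotient *)

Section QuotientMeasure.
Variables (G L : groupType) (SG : set G) (SL : set L).
Variable h : cayley_isometric SG SL.

Lemma measurable_open_iso (U : set (iso_borel h)) :
  @open (iso_space h) U -> measurable U.
Proof. exact: sub_sigma_algebra. Qed.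

Lemma measurable_open_quot (U : set (iso_quot_borel h)) :
  @open (iso_quot h) U -> measurable U.
Proof. exact: sub_sigma_algebra. Qed.

(** Membership depends on two values of [f], so the set is open. *)
Lemma measurable_values (x y : G) (P : L -> L -> Prop) :
  measurable ([set f : iso_space h | P (iso_fun f x) (iso_fun f y)] : set (iso_borel h)).
Proof.
apply: measurable_open_iso; apply/open_iso_agree => f Pf; exists [:: x; y] => g gf.
by rewrite /= !gf ?inE ?eqxx ?orbT.
Qed.

Lemma measurable_class_of :
  measurable_fun setT (class_of h : iso_borel h -> iso_quot_borel h).
Proof.
apply: (@measurability _ _ (iso_borel h) (iso_quot_borel h) setT _ (@open (iso_quot h))) => //.
by move=> _ [U oU <-]; rewrite setTI; exact: measurable_open_iso.
Qed.

Lemma measurable_preimage_class_of (A : set (iso_quot_borel h)) :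
  measurable A -> measurable (class_of h @^-1` A : set (iso_borel h)).
Proof.
by move=> mA; rewrite -[X in measurable X]setTI; exact: measurable_class_of.
Qed.

Variables (G' L' : groupType) (SG' : set G') (SL' : set L').
Variable h' : cayley_isometric SG' SL'.

(** The hypothesis says that [T] is continuous; it is easy to check for maps
    given by formulas for their normal forms. *)
Lemma measurable_locally_constant (T : iso_quot_borel h -> iso_quot_borel h') :
  (forall q x, exists s : seq G, forall q',
    {in s, forall y, nrm q' y = nrm q y} -> nrm (T q') x = nrm (T q) x) ->
  measurable_fun setT T.
Proof.
move=> Tloc; apply: (@measurability _ _ (iso_quot_borel h) (iso_quot_borel h')
  setT _ (@open (iso_quot h'))) => //.
move=> _ [U /open_quot_agree oU <-]; rewrite setTI.
apply: measurable_open_quot; apply/open_quot_agree => q /oU[s sU].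
suff [t tT] : exists t : seq G, forall q', {in t, forall y, nrm q' y = nrm q y} ->
    {in s, forall x, nrm (T q') x = nrm (T q) x}.
  by exists t => q' /tT; exact: sU.
elim: s {sU} => [|x s [t tT]]; first by exists [::].
have [u uT] := Tloc q x; exists (u ++ t) => q' q'q y; rewrite inE => /predU1P[->|].
  by apply: uT => z zu; apply: q'q; rewrite mem_cat zu.
by apply: tT => z zt; apply: q'q; rewrite mem_cat zt orbT.
Qed.

End QuotientMeasure.

(** * Inversion of normal forms *)

Section QuotientInverse.
Variables (G L : groupType) (SG : set G) (SL : set L).
Variables (h : cayley_isometric SG SL) (h' : cayley_isometric SL SG).

Definition quot_inv (q : iso_quot_borel h) : iso_quot_borel h' :=
  class_of h' (iso_inv (nrm q)).

Lemma nrm_quot_inv q : nrm (quot_inv q) = iso_inv (nrm q).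
Proof. by rewrite nrm_class_of rebase_id // iso_inv1 // nrm1. Qed.

Lemma measurable_quot_inv : measurable_fun setT quot_inv.
Proof.
apply: measurable_locally_constant => q x; exists [:: iso_inv (nrm q) x] => q' q'q.
rewrite !nrm_quot_inv; apply: (can_inj (iso_invK (nrm q'))).
by rewrite iso_invVK q'q ?inE// iso_invVK.
Qed.

End QuotientInverse.

Arguments quot_inv {G L SG SL} h h' q.

Lemma quot_invK (G L : groupType) (SG : set G) (SL : set L)
    (h : cayley_isometric SG SL) (h' : cayley_isometric SL SG) :
  cancel (quot_inv h h') (quot_inv h' h).
Proof. by move=> q; apply: nrm_inj; rewrite !nrm_quot_inv iso_inv_inv. Qed.

(** With [f] the normal form of [q], the generator [s] acting on [q] becomes
    the generator [(f s^-1)^-1] acting on the image of [q]. *)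
Lemma quot_inv_edge (G L : groupType) (SG : set G) (SL : set L)
    (h : cayley_isometric SG SL) (h' : cayley_isometric SL SG) q q' :
  finite_generating_system SG -> finite_generating_system SL ->
  action_edge SG (quot_act h) q q' ->
  action_edge SL (quot_act h') (quot_inv h h' q) (quot_inv h h' q').
Proof.
move=> fG fL [s Ss <-]; set f := nrm q.
have [l Sl fs] : cayley_edge SL (f 1)%g (f s^-1)%g.
  apply: iso_cayley_edge => //; exists s^-1%g; last by rewrite mul1g.
  exact: (fgs_symmetric fG).
exists (f s^-1)^-1%g; first by rewrite fs nrm1 mul1g; exact: (fgs_symmetric fL).
apply: nrm_inj; apply: iso_ext => y; rewrite nrm_quot_act !nrm_quot_inv invgK.
apply: (can_inj (iso_invK (nrm (quot_act h s q)))).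
by rewrite iso_invVK nrm_quot_act iso_invK invgK mulKg iso_invVK mulKg.
Qed.

Lemma quot_inv_dist (G L : groupType) (SG : set G) (SL : set L)
    (h : cayley_isometric SG SL) (h' : cayley_isometric SL SG) q q' :
  finite_generating_system SG -> finite_generating_system SL ->
  action_dist SL (quot_act h') (quot_inv h h' q) (quot_inv h h' q') =
  action_dist SG (quot_act h) q q'.
Proof.
move=> fG fL; apply: eq_graph_dist => n; split.
  have K : cancel (quot_inv h h') (quot_inv h' h) by exact: quot_invK.
  move=> w; rewrite -[q]K -[q']K; apply: walk_homo w => x y; exact: quot_inv_edge.
by apply: walk_homo => x y; exact: quot_inv_edge.
Qed.

(** * Measures and countable partitions *)

Section CountablePartition.
Local Open Scope ring_scope.
Local Open Scope ereal_scope.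
Context {R : realType} d (X : measurableType d) (I : Type).
Hypothesis cI : countable [set: I].
Variable K : X -> I.
Hypothesis mK : forall i, measurable (K @^-1` [set i]).

Lemma measurable_countable_fiber (A : set X) (r : I -> nat) n :
  measurable A -> measurable (A `&` (r \o K) @^-1` [set n]).
Proof.
move=> mA; apply: measurableI => //.
rewrite (_ : _ @^-1` _ = \bigcup_i (if r i == n then K @^-1` [set i] else set0)).
  by apply: countable_bigcupT_measurable => // i; case: ifP.
apply/seteqP; split=> [x /= <-|x [i _]]; first by exists (K x); rewrite // eqxx.
by case: ifP => // /eqP <- /= ->.
Qed.

Lemma measure_countable_fiber (mu : {measure set X -> \bar R}) (A : set X)
    (r : I -> nat) : measurable A ->
  mu A = \sum_(n <oo) mu (A `&` (r \o K) @^-1` [set n]).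
Proof.
move=> mA; rewrite {1}(_ : A = \bigcup_n (A `&` (r \o K) @^-1` [set n])).
  rewrite measure_bigcup //=; first by apply: eq_eseriesl => n; rewrite in_setT.
    by move=> n _; exact: measurable_countable_fiber.
  by apply/trivIsetP => i j _ _; apply: contra_neqP => /eqP/set0P[x [[_ /= <-] [_ /= <-]]].
by apply/seteqP; split=> [x Ax|x [n _ []//]]; exists (r (K x)).
Qed.

Definition uniform_on_fibers (m : set X -> \bar R) := forall i j,
  K @^-1` [set i] !=set0 -> K @^-1` [set j] !=set0 ->
  m (K @^-1` [set i]) = m (K @^-1` [set j]).

(** By uniformity the inequality at the fiber over [i] holds at all fibers; summed
    over the others, it holds at the complement of the fiber over [i].  As the
    total masses agree, it is reversed at that fiber itself. *)
Lemma uniform_fibers_le (m m' : probability X R) i :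
  uniform_on_fibers m -> uniform_on_fibers m' -> K @^-1` [set i] !=set0 ->
  m (K @^-1` [set i]) <= m' (K @^-1` [set i]) ->
  m' (K @^-1` [set i]) <= m (K @^-1` [set i]).
Proof.
move=> um um' i0 lem.
have [r /in2TT ri] := countable_injP _ cI.
have fm (p : probability X R) : p (K @^-1` [set i]) = 1 - p (~` (K @^-1` [set i])).
  by rewrite -probability_setC ?setCK//; exact: measurableC.
rewrite (fm m) (fm m'); apply: leeB => //.
have mC : measurable (~` (K @^-1` [set i])) by exact: measurableC.
(* The complement meets each fiber over [j <> i] in the whole fiber. *)
rewrite (measure_countable_fiber _ r mC) (measure_countable_fiber m' r mC).
apply: lee_nneseries => // n _.
have [[j ji rj]|nj] := pselect (exists2 j, j <> i & r j = n); last first.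
  rewrite (_ : _ `&` _ = set0) ?measure0//; apply/seteqP; split=> // x [/= xi rx].
  by apply: nj; exists (K x).
rewrite (_ : _ `&` _ = K @^-1` [set j]).
  have [->|/set0P j0] := eqVneq (K @^-1` [set j]) set0; first by rewrite !measure0.
  by move: lem; rewrite (um i j) // (um' i j).
apply/seteqP; split=> x /=; first by move=> [_]; rewrite -rj => /ri.
by move=> ->.
Qed.

Lemma uniform_fibers_unique (m m' : probability X R) i :
  uniform_on_fibers m -> uniform_on_fibers m' ->
  m (K @^-1` [set i]) = m' (K @^-1` [set i]).
Proof.
move=> um um'; have [->|/set0P i0] := eqVneq (K @^-1` [set i]) set0.
  by rewrite !measure0.
apply/eqP; rewrite eq_le; apply/andP.
have /orP[le|le] := le_total (m (K @^-1` [set i])) (m' (K @^-1` [set i])).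
  by split=> //; exact: uniform_fibers_le le.
by split=> //; exact: uniform_fibers_le le.
Qed.

End CountablePartition.

(** * Invariance of the Haar probability measure *)

Section HaarProbability.
Local Open Scope ring_scope.
Local Open Scope ereal_scope.
Context {R : realType}.
Variables (G L : groupType) (SG : set G) (SL : set L).
Hypothesis cL : countable [set: L].
Variable h : cayley_isometric SG SL.

Lemma measurable_fund_dom : measurable (@fund_dom _ _ _ _ h : set (iso_borel h)).
Proof. exact: (@measurable_values _ _ _ _ h 1%g 1%g (fun l _ => l = 1%g)). Qed.

(** Both [f x = 1] and [f 1 = 1] define fundamental domains for postcomposition
    by translations.  Split the first by [l = f 1] and the second by
    [l = (f x)^-1]: translation by [l] carries the second piece onto the first,
    and preserves the mass. *)
Lemma haar_change_fund_dom (mu : {measure set (iso_borel h) -> \bar R}) (x : G)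
    (A : set (iso_quot_borel h)) : is_haar mu -> measurable A ->
  mu ([set f | iso_fun f x = 1%g] `&` class_of h @^-1` A) =
  mu (@fund_dom _ _ _ _ h `&` class_of h @^-1` A).
Proof.
move=> hmu mA; have [r /in2TT ri] := countable_injP _ cL.
have mB := measurable_preimage_class_of mA.
have mx : measurable ([set f | iso_fun f x = 1%g] : set (iso_borel h)).
  exact: (@measurable_values _ _ _ _ h x x (fun l _ => l = 1%g)).
have m1 l : measurable ((fun f : iso_borel h => iso_fun f 1%g) @^-1` [set l]).
  exact: (@measurable_values _ _ _ _ h 1%g 1%g (fun k _ => k = l)).
have m2 l : measurable ((fun f : iso_borel h => (iso_fun f x)^-1)%g @^-1` [set l]).
  exact: (@measurable_values _ _ _ _ h x x (fun k _ => k^-1 = l)%g).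
rewrite (measure_countable_fiber cL m1 _ r); last exact: measurableI.
rewrite (measure_countable_fiber cL m2 _ r); last first.
  by apply: measurableI => //; exact: measurable_fund_dom.
apply: eq_eseriesr => n _.
have [[l <-]|nl] := pselect (exists l, r l = n); last first.
  have e0 (k : iso_borel h -> L) (B : set (iso_borel h)) :
      B `&` (r \o k) @^-1` [set n] = set0.
    by apply/seteqP; split=> // f [_ kn]; apply: nl; exists (k f).
  by rewrite !e0 !measure0.
rewrite -(haar_post hmu (ltrans SL l)); last first.
  apply: measurable_countable_fiber => //; exact: measurableI.
congr (mu _); apply/seteqP.
have lE f y : iso_fun (iso_comp (ltrans SL l) f) y = (l * iso_fun f y)%g by [].
split=> f /=; rewrite /fund_dom /= !lE class_of_postcomp.
  move=> [[lx Af] /ri l1]; split; first split=> //.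
    by apply: (@mulgI _ l); rewrite mulg1.
  by congr (r _); rewrite -[RHS](mulgK (iso_fun f x)) lx mul1g.
move=> [[f1 Af] /ri lx]; rewrite f1 mulg1; split=> //; split=> //.
by rewrite -lx mulVg.
Qed.

End HaarProbability.

Section Invariance.
Local Open Scope ring_scope.
Local Open Scope ereal_scope.
Context {R : realType}.
Variables (G L : groupType) (SG : set G) (SL : set L).
Variable h : cayley_isometric SG SL.
Variable m : probability (iso_quot_borel h) R.
Hypothesis haarm : is_haar_probability m.

Lemma measurable_quot_act g : measurable_fun setT (quot_act h g).
Proof.
apply: measurable_locally_constant => q x; exists [:: g^-1; g^-1 * x]%g => q' q'q.
by rewrite !nrm_quot_act !q'q ?inE ?eqxx ?orbT.
Qed.

(** Precomposition by [g] moves the condition [f 1 = 1] to [f g = 1], another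
    fundamental domain. *)
Lemma haar_probability_act (cL : countable [set: L]) g (A : set (iso_quot_borel h)) :
  measurable A -> m (quot_act h g @^-1` A) = m A.
Proof.
move=> mA; have [mu [c [hmu mE]]] := haarm.
have mB := measurable_preimage_class_of mA.
have mgA : measurable (quot_act h g @^-1` A).
  by rewrite -[X in measurable X]setTI; exact: measurable_quot_act.
rewrite !mE //; congr (_ * _).
have mg : measurable ([set f | iso_fun f g = 1%g] : set (iso_borel h)).
  exact: (@measurable_values _ _ _ _ h g g (fun l _ => l = 1%g)).
rewrite -(haar_change_fund_dom cL g hmu mA).
rewrite -(haar_pre hmu (ltrans SG g) (measurableI _ _ mg mB)).
congr (mu _); apply/seteqP; rewrite iso_inv_ltrans.
have gE (f : iso_space h) : iso_fun (iso_comp f (ltrans SG g^-1%g)) g = iso_fun f 1%g.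
  by rewrite iso_compE ltransE mulVg.
by split=> f; rewrite /fund_dom /= gE quot_act_class.
Qed.

(** A measure-preserving map that respects the condition [f 1 = 1] acts on normal
    forms, and so induces a measure-preserving map of the quotient. *)
Lemma haar_probability_stab (T : iso_space h -> iso_space h) :
  (forall f, iso_fun (T f) 1%g = 1%g <-> iso_fun f 1%g = 1%g) ->
  (forall mu : {measure set (iso_borel h) -> \bar R}, is_haar mu ->
    forall A : set (iso_borel h), measurable A -> mu (T @^-1` A) = mu A) ->
  forall A : set (iso_quot_borel h), measurable A ->
  measurable ([set q | A (class_of h (T (nrm q)))] : set (iso_quot_borel h)) ->
  m [set q | A (class_of h (T (nrm q)))] = m A.
Proof.
move=> T1 Tmu A mA mTA; have [mu [c [hmu mE]]] := haarm.
rewrite !mE //; congr (_ * _).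
rewrite -[RHS](Tmu _ hmu); last first.
  by apply: measurableI; [exact: measurable_fund_dom|exact: measurable_preimage_class_of].
congr (mu _); apply/seteqP; split=> f /=; rewrite /fund_dom /=.
  by move=> [f1]; rewrite nrm_class_of rebase_id // T1.
by move=> [/T1 f1]; rewrite nrm_class_of rebase_id.
Qed.

Definition quot_post (psi : iso SL SL) (q : iso_quot_borel h) : iso_quot_borel h :=
  class_of h (iso_comp psi (nrm q)).

Lemma nrm_quot_post (psi : iso SL SL) q : psi 1%g = 1%g ->
  nrm (quot_post psi q) = iso_comp psi (nrm q).
Proof. by move=> psi1; rewrite nrm_class_of rebase_id // iso_compE nrm1. Qed.

Lemma measurable_quot_post (psi : iso SL SL) : psi 1%g = 1%g ->
  measurable_fun setT (quot_post psi).
Proof.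
move=> psi1; apply: measurable_locally_constant => q x; exists [:: x] => q' q'q.
by rewrite !nrm_quot_post // (iso_compE _ (nrm q')) (iso_compE _ (nrm q)) q'q ?inE.
Qed.

Definition quot_pre (phi : iso SG SG) (q : iso_quot_borel h) : iso_quot_borel h :=
  class_of h (iso_comp (nrm q) (iso_inv phi)).

Lemma nrm_quot_pre (phi : iso SG SG) q : phi 1%g = 1%g ->
  nrm (quot_pre phi q) = iso_comp (nrm q) (iso_inv phi).
Proof.
by move=> phi1; rewrite nrm_class_of rebase_id // iso_compE iso_inv1 // nrm1.
Qed.

Lemma measurable_quot_pre (phi : iso SG SG) : phi 1%g = 1%g ->
  measurable_fun setT (quot_pre phi).
Proof.
move=> phi1; apply: measurable_locally_constant => q x.
exists [:: iso_inv phi x] => q' q'q.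
by rewrite !nrm_quot_pre // (iso_compE (nrm q')) (iso_compE (nrm q)) q'q ?inE.
Qed.

Lemma haar_probability_post (psi : iso SL SL) (A : set (iso_quot_borel h)) :
  psi 1%g = 1%g -> measurable A -> m (quot_post psi @^-1` A) = m A.
Proof.
move=> psi1 mA; apply: (@haar_probability_stab (fun f => iso_comp psi f)) => //.
- move=> f; rewrite iso_compE; split=> [|->//].
  by move=> e; apply: (can_inj (iso_invK psi)); rewrite e psi1.
- by move=> mu hmu B mB; exact: haar_post.
- rewrite -[X in measurable X]setTI; exact: measurable_quot_post.
Qed.

Lemma haar_probability_pre (phi : iso SG SG) (A : set (iso_quot_borel h)) :
  phi 1%g = 1%g -> measurable A -> m (quot_pre phi @^-1` A) = m A.
Proof.
move=> phi1 mA; apply: (@haar_probability_stab (fun f => iso_comp f (iso_inv phi))) => //.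
- by move=> f; rewrite iso_compE iso_inv1.
- by move=> mu hmu B mB; exact: haar_pre.
- rewrite -[X in measurable X]setTI; exact: measurable_quot_pre.
Qed.

End Invariance.

(** * Uniqueness of the invariant probability measure *)

Section Uniqueness.
Local Open Scope ring_scope.
Local Open Scope ereal_scope.
Context {R : realType}.
Variables (G L : groupType) (SG : set G) (SL : set L).
Hypotheses (cG : countable [set: G]) (cL : countable [set: L]).
Variable h : cayley_isometric SG SL.

Definition stab_invariant (m : probability (iso_quot_borel h) R) :=
  forall (psi : iso SL SL) (A : set (iso_quot_borel h)),
    psi 1%g = 1%g -> measurable A -> m (quot_post psi @^-1` A) = m A.

Definition values_at (s : seq G) (q : iso_quot_borel h) : seq L := map (nrm q) s.

Lemma measurable_values_at s v : measurable (values_at s @^-1` [set v]).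
Proof.
apply: measurable_open_quot; apply/open_quot_agree => q qv; exists s => q' q'q.
by rewrite /= -qv; apply/eq_in_map => x xs; exact: q'q.
Qed.

(** Given normal forms [p] and [q], the isometry [q \o p^-1] fixes the identity
    and carries the fiber of [p] onto the fiber of [q]. *)
Lemma stab_invariant_values_at m s v w : stab_invariant m ->
  values_at s @^-1` [set v] !=set0 -> values_at s @^-1` [set w] !=set0 ->
  m (values_at s @^-1` [set v]) = m (values_at s @^-1` [set w]).
Proof.
move=> im [p pv] [q qw].
pose psi := iso_comp (nrm q) (iso_inv (nrm p)).
have psi1 : psi 1%g = 1%g by rewrite iso_compE iso_inv1 ?nrm1.
rewrite -(im psi _ psi1 (measurable_values_at s w)); congr (m _).
have psiK : cancel psi (iso_inv psi) := iso_invK psi.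
have psiv : map psi v = w.
  rewrite -pv -qw /values_at -map_comp; apply: eq_map => x /=.
  by rewrite iso_compE iso_invK.
apply/seteqP; split=> z /=.
  by rewrite /values_at nrm_quot_post // -psiv => <-; rewrite -map_comp.
rewrite /values_at nrm_quot_post // -psiv => zv.
by apply: (inj_map (can_inj psiK)); rewrite -zv -map_comp.
Qed.

(** The cylinders with a fixed list of base points are the fibers of the map
    [values_at], on which an invariant measure is uniform. *)
Lemma stab_invariant_unique (m1 m2 : probability (iso_quot_borel h) R) :
  stab_invariant m1 -> stab_invariant m2 ->
  forall A, measurable A -> m1 A = m2 A.
Proof.
move=> i1 i2 A mA.
have m1T : nat -> m1 setT < +oo by rewrite probability_setT ltry.
apply: (@measure_unique _ R (iso_quot_borel h) (@cylinders _ _ _ _ h) (fun=> setT)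
  _ _ _ _ m1 m2) mA.
- exact: sigma_cylinders.
- exact: setI_closed_cylinders.
- by move=> _; exists [::] => //; apply/seteqP; split.
- by apply: bigcup_const; exists 0%N.
- move=> _ [w _ <-].
  rewrite (_ : cylinder w = values_at (map fst w) @^-1` [set map snd w]).
    apply: (uniform_fibers_unique (countable_seq cL) (measurable_values_at _)) => v u.
      exact: stab_invariant_values_at.
    exact: stab_invariant_values_at.
  apply/seteqP; split=> q.
    by move=> qw; rewrite /= /values_at -map_comp; apply/eq_in_map.
  by rewrite /= /values_at -map_comp => /eq_in_map.
- exact: m1T.
Qed.

Variable h' : cayley_isometric SL SG.

(** Inversion exchanges postcomposition by the stabilizer of the identity with
    precomposition, and Haar measures are invariant under both. *)
Lemma haar_probability_quot_inv (m : probability (iso_quot_borel h) R)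
    (m' : probability (iso_quot_borel h') R) :
  is_haar_probability m -> is_haar_probability m' ->
  forall A, measurable A -> m (quot_inv h h' @^-1` A) = m' A.
Proof.
move=> hm hm'.
pose P : {mfun iso_quot_borel h' >-> iso_quot_borel h} := HB.pack (quot_inv h' h)
  (isMeasurableFun.Build _ _ _ _ _ (@measurable_quot_inv _ _ _ _ h' h)).
have mP (A : set (iso_quot_borel h)) : measurable A -> measurable (P @^-1` A).
  by move=> mA; rewrite -[X in measurable X]setTI; exact: measurable_quot_inv.
have eq_m A : measurable A -> m A = distribution m' P A.
  apply: stab_invariant_unique => psi B psi1 mB; first exact: haar_probability_post.
  apply: etrans (haar_probability_pre hm' psi1 (mP B mB)).
  have postE : quot_post psi \o P = P \o quot_pre psi.
    apply/funext => q; apply: nrm_inj => /=; rewrite nrm_quot_post // !nrm_quot_inv.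
    by rewrite nrm_quot_pre // iso_inv_comp iso_inv_inv.
  change (m' ((quot_post psi \o P) @^-1` B) = m' ((P \o quot_pre psi) @^-1` B)).
  by rewrite postE.
move=> A mA; rewrite eq_m; last first.
  by rewrite -[X in measurable X]setTI; exact: measurable_quot_inv.
rewrite /distribution /pushforward -comp_preimage; congr (m' _).
by apply/seteqP; split=> q /=; rewrite quot_invK.
Qed.

End Uniqueness.

(** * The quotient as a standard Borel space *)

Section Metric.
Local Open Scope ring_scope.
Context {R : realType}.
Variables (G L : groupType) (SG : set G) (SL : set L).
Variable h : cayley_isometric SG SL.
Variables (eG : nat -> G) (eL : nat -> L).
Hypotheses (eG_surj : forall x, exists n, eG n = x)
           (eL_surj : forall y, exists n, eL n = y).

(** Comparing inverses as well makes limits bijective for formal reasons, as in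
    the group of permutations of a countable set; comparing values alone would
    require the finiteness of balls. *)
Definition agree_upto (eps : R) (q q' : iso_quot h) :=
  forall n, eps <= n.+1%:R^-1 ->
    nrm q' (eG n) = nrm q (eG n) /\ iso_inv (nrm q') (eL n) = iso_inv (nrm q) (eL n).

(** A copy of the quotient to carry the metric; the enumerations and the field
    occur in the type so that they can be recovered from it. *)
Definition iso_metric (_ : realType) (_ : forall x, exists n, eG n = x)
  (_ : forall y, exists n, eL n = y) : Type := iso_quot h.

Local Notation M := (iso_metric R eG_surj eL_surj).

HB.instance Definition _ := Choice.on M.
HB.instance Definition _ := Pointed.on M.

Definition iso_ball (q : M) (eps : R) (q' : M) : Prop :=
  0 < eps /\ agree_upto eps q q'.

Lemma iso_ball_center q (eps : R) : 0 < eps -> iso_ball q eps q.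
Proof. by []. Qed.

Lemma iso_ball_sym q q' (eps : R) : iso_ball q eps q' -> iso_ball q' eps q.
Proof. by move=> [e0 qq']; split=> // n /qq'[]. Qed.

Lemma iso_ball_triangle p q r (e1 e2 : R) :
  iso_ball p e1 q -> iso_ball q e2 r -> iso_ball p (e1 + e2) r.
Proof.
move=> [e10 pq] [e20 qr]; split=> [|n en]; first exact: addr_gt0.
have [] := pq n; first by apply: le_trans en; rewrite lerDl ltW.
have [] := qr n; first by apply: le_trans en; rewrite lerDr ltW.
by move=> -> -> -> ->.
Qed.

HB.instance Definition _ := hasNbhs.Build M (nbhs_ (entourage_ iso_ball)).
HB.instance Definition _ := Nbhs_isPseudoMetric.Build R M
  erefl iso_ball_center iso_ball_sym iso_ball_triangle erefl.

Lemma ltr_inv_natS (eps : R) : 0 < eps -> exists N : nat, N.+1%:R^-1 < eps.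
Proof.
move=> e0; exists (Num.truncn eps^-1); rewrite invf_plt ?posrE //.
exact: truncnS_gt.
Qed.

(** The metric defines the quotient topology: prescribing the inverse of a normal
    form at [y] amounts to prescribing the normal form at one point. *)
Lemma nbhs_iso_metric (q : M) (U : set M) : nbhs q U <->
  exists s : seq G, forall q' : M, {in s, forall x, nrm q' x = nrm q x} -> U q'.
Proof.
split=> [/nbhs_ballP[eps /= e0 qU]|[s sU]].
  have [N Ne] := ltr_inv_natS e0.
  exists ([seq eG n | n <- iota 0 N] ++ [seq iso_inv (nrm q) (eL n) | n <- iota 0 N]).
  move=> q' q'q; apply: qU; split=> // n en.
  have nN : n \in iota 0 N.
    rewrite mem_iota leq0n add0n ltnNge; apply/negP => Nn.
    have := lt_le_trans Ne en; rewrite ltf_pV2 ?posrE ?ltr0n // ltr_nat ltnS ltnNge.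
    by rewrite Nn.
  split; first by apply: q'q; rewrite mem_cat (map_f eG nN).
  apply: (can_inj (iso_invK (nrm q'))); rewrite iso_invVK q'q ?iso_invVK //.
  by rewrite mem_cat (map_f (fun n => iso_inv (nrm q) (eL n)) nN) orbT.
have [N Ns] : exists N, {in s, forall x, exists2 n, (n <= N)%N & eG n = x}.
  elim: s {sU} => [|x s [N Ns]]; first by exists 0%N.
  have [n nx] := eG_surj x; exists (maxn n N) => y.
  rewrite in_cons => /predU1P[->|/Ns[k kN ky]].
    by exists n => //; exact: leq_maxl.
  by exists k => //; rewrite leq_max kN orbT.
apply/nbhs_ballP; exists N.+1%:R^-1 => /=; first by rewrite invr_gt0.
move=> q' [_ q'q]; apply: sU => x /Ns[n nN <-]; apply: (q'q n _).1.
by rewrite lef_pV2 ?posrE ?ltr0n // ler_nat ltnS.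
Qed.

Lemma open_iso_metric (U : set M) : open U <-> @open (iso_quot h) U.
Proof.
rewrite open_quot_agree openE; split=> oU q /oU; first by move/nbhs_iso_metric.
by move=> sU; apply/nbhs_iso_metric.
Qed.

Lemma hausdorff_iso_metric : hausdorff_space M.
Proof.
move=> p q pq; apply: nrm_inj; apply: iso_ext => x.
have nx (r : M) : nbhs r [set q' | nrm q' x = nrm r x].
  by apply/nbhs_iso_metric; exists [:: x] => q' q'r; apply: q'r; rewrite inE.
by have [r [/= <- <-]] := pq _ _ (nx p) (nx q).
Qed.

Lemma separable_iso_metric : countable [set: G] -> countable [set: L] ->
  exists2 D : set M, countable D & dense D.
Proof.
move=> cG cL; pose pick w : M := xget point (cylinder (h := h) w).
exists (range pick).
  apply: (@sub_countable _ _ _ [set: seq (G * L)]); first exact: card_image_le.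
  exact/countable_seq/countable_prod.
move=> U [q Uq] /open_iso_metric/open_quot_agree/(_ _ Uq)[s sU].
pose w := [seq (x, nrm q x) | x <- s]; exists (pick w); split; last by exists w.
have /(xgetI point) : cylinder (h := h) w q by move=> p /mapP[x _ ->].
by move=> pw; apply: sU => x xs; apply: (pw (x, nrm q x)); apply: map_f.
Qed.

(** Along a Cauchy filter each value of the normal form and of its inverse is
    eventually constant.  The two limits are inverse to each other, and
    every relation between finitely many values, such as a distance, passes to
    the limit. *)
Lemma iso_metric_complete (F : set_system M) : ProperFilter F -> cauchy F -> cvg F.
Proof.
move=> FF /cauchyP Fc.
have [f fF] : {f : G -> L & forall x, F [set q : M | nrm q x = f x]}.
  apply: (@choice _ _ (fun x l => F [set q : M | nrm q x = l])) => x.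
  have [n <-] := eG_surj x.
  have [|q Fq] := Fc n.+1%:R^-1; first by rewrite invr_gt0.
  exists (nrm q (eG n)); apply: filterS Fq => q' [_ /(_ n (lexx _))[]//].
have [g gF] : {g : L -> G & forall y, F [set q : M | iso_inv (nrm q) y = g y]}.
  apply: (@choice _ _ (fun y x => F [set q : M | iso_inv (nrm q) y = x])) => y.
  have [n <-] := eL_surj y.
  have [|q Fq] := Fc n.+1%:R^-1; first by rewrite invr_gt0.
  exists (iso_inv (nrm q) (eL n)); apply: filterS Fq => q' [_ /(_ n (lexx _))[]//].
have fK : cancel f g.
  by move=> x; have [q [/= <- <-]] := filter_ex (filterI (fF x) (gF (f x)));
    rewrite iso_invK.
have gK : cancel g f.
  by move=> y; have [q [/= <- <-]] := filter_ex (filterI (fF (g y)) (gF y));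
    rewrite iso_invVK.
have fI : iso_set SG SL f.
  split=> [|x y]; first by exists g.
  have [q [/= <- <-]] := filter_ex (filterI (fF x) (fF y)).
  by have [_ ->] := isoP (nrm q).
have f1 : f 1%g = 1%g by have [q /= <-] := filter_ex (fF 1%g); rewrite nrm1.
apply/cvg_ex; exists (class_of h (iso_mk fI) : M) => U /nbhs_iso_metric[s sU].
apply: filterS sU _; rewrite nrm_class_of rebase_id //.
elim: s => [|x s IH]; first exact: filterE.
apply: filterS (filterI (fF x) IH) => q [qx qs] y; rewrite inE => /predU1P[->//|].
exact: qs.
Qed.

HB.instance Definition _ := Uniform_isComplete.Build M iso_metric_complete.

Lemma standard_borel_iso_quot : countable [set: G] -> countable [set: L] ->
  standard_borel (R := R) (iso_quot_borel h).
Proof.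
move=> cG cL.
exists M, id; split.
- exact: hausdorff_iso_metric.
- exact: separable_iso_metric.
- by exists id.
- move=> A; rewrite image_id.
  suff -> : @open M = @open (iso_quot h) by [].
  by apply/seteqP; split=> U /open_iso_metric.
Qed.

End Metric.

(** * The isometric orbit equivalence *)

Lemma quot_act_pmp (R : realType) (G L : groupType) (SG : set G) (SL : set L)
    (h : cayley_isometric SG SL) (m : probability (iso_quot_borel h) R) :
  finite_generating_system SG -> finite_generating_system SL ->
  is_haar_probability m -> pmp_action m (quot_act h).
Proof.
move=> fG fL hm.
have cG := countable_fgs fG; have cL := countable_fgs fL.
split.
- have [eG eGs] := countable_enum 1%g cG; have [eL eLs] := countable_enum 1%g cL.
  exact: (standard_borel_iso_quot _ eGs eLs).
- exact: quot_act1.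
- exact: quot_actM.
- exact: measurable_quot_act.
- by move=> g A mA; exact: haar_probability_act.
Qed.

Theorem corollary3p2 (R : realType) (G L : groupType) (SG : set G) (SL : set L)
    (fgG : finite_generating_system SG) (fgL : finite_generating_system SL)
    (hGL : cayley_isometric SG SL)
    (mL : probability (iso_quot_borel hGL) R)
    (mG : probability (iso_quot_borel (cayley_isometric_sym hGL)) R)
    (haarL : is_haar_probability mL) (haarG : is_haar_probability mG) :
  [/\ pmp_action mL (quot_act hGL),
      pmp_action mG (quot_act (cayley_isometric_sym hGL)) &
      isometric_orbit_equivalent SG SL mL mG
        (quot_act hGL)
        (quot_act (cayley_isometric_sym hGL))].
Proof.
split; [exact: quot_act_pmp | exact: quot_act_pmp |].
set h' := cayley_isometric_sym hGL in mG haarG *.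
exists (quot_inv hGL h'), (quot_inv h' hGL), setT; split.
- by split; exact: quot_invK.
- by split; exact: measurable_quot_inv.
- have [cG cL] := (countable_fgs fgG, countable_fgs fgL).
  exact: (haar_probability_quot_inv cG cL haarL haarG).
- split; [by [] | exact: probability_setT | exact: invariant_setT_quot_act |].
  rewrite (_ : _ @` _ = setT); first exact: invariant_setT_quot_act.
  apply/seteqP; split=> // q _.
  by exists (quot_inv h' hGL q) => //; exact: quot_invK.
- by move=> q q' _ _; exact: quot_inv_dist.
Qed.
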